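(* Let $\mu$ be the Gibbs measure on $\Sigma_A$ of a Hölder continuous potential that is not cohomologous to a constant. Let $\psi:\mathbb N\to\mathbb N$ be such that $\psi(n)\le n$ for all $n$ sufficiently large and $\lim_{n\to\infty}\psi(n)=\infty$. Suppose there exist an increasing sequence $(n_k)_{k\ge1}$ of natural numbers and a function $g:\mathbb N\to[1,\infty)$ with $\lim_{n\to\infty}g(n)/g(n+1)=1$ such that $$\mu\left(\left\{\mathbf i\in\Sigma_A:\limsup_{k\to\infty}\frac{\log\mu([\mathbf i|_1^{n_k}])+h_\mu n_k}{\sqrt{2\rho_\mu n_k}\,g(n_k)}>1\right\}\right)=1$$ and $$\lim_{k\to\infty}\#\psi^{-1}(n_k)\,e^{-h_\mu n_k+\sqrt{2\rho_\mu n_k}\,g(n_k)}=\infty.$$ Then $$\mu\left(\left\{\mathbf i\in\Sigma_A: d(\sigma^p\mathbf i,\mathbf i)\le K^{-n_k}\text{ for some }p\in\psi^{-1}(n_k),\text{ for infinitely many }k\in\mathbb N\right\}\right)=1.$$ Moreover, $\mu(R_\psi)=1$.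
   Context: Let $K\ge 2$ be an integer and $\Sigma=\{1,\dots,K\}^{\mathbb N}$. For sequences $\mathbf i,\mathbf j$ let $|\mathbf i\wedge\mathbf j|=\inf\{n\ge 0: i_{n+1}\neq j_{n+1}\}$, and equip $\Sigma$ with the metric $d(\mathbf i,\mathbf j)=K^{-|\mathbf i\wedge\mathbf j|}$. Let $A$ be a $K\times K$ matrix with entries in $\{0,1\}$ such that for some $M\in\mathbb N$ all entries of $A^M$ are strictly positive, let $\Sigma_A=\{\mathbf i\in\Sigma: A_{i_l,i_{l+1}}=1\text{ for all } l\in\mathbb N\}$, and let $\sigma$ be the left shift on $\Sigma_A$. Let $\Sigma_{A,n}$ be the set of words $i_1\dots i_n$ with $A_{i_l,i_{l+1}}=1$ for $1\le l\le n-1$, $[w]=\{\mathbf j\in\Sigma_A:\mathbf j\text{ begins with } w\}$, and $\mathbf i|_1^n=i_1\dots i_n$. A function $f:\Sigma_A\to\mathbb R$ is Hölder continuous if $|f(\mathbf i)-f(\mathbf j)|\le b\alpha^{|\mathbf i\wedge\mathbf j|}$ for some $b>0$, $0<\alpha<1$. Its pressure is $P(f)=\lim_{n}\frac1n\log\sum_{w\in\Sigma_{A,n}}\sup_{\mathbf j\in[w]}\exp(\sum_{k=0}^{n-1}f(\sigma^k\mathbf j))$. The Gibbs measure of $f$ is the unique $\sigma$-invariant ergodic probability measure $\mu$ on $\Sigma_A$ for which there is $C>1$ with $C^{-1}\le \mu([\mathbf i|_1^n])/\exp(-nP(f)+\sum_{k=0}^{n-1}f(\sigma^k\mathbf i))\le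 C$ for all $\mathbf i,n$. Entropy: $h_\mu=\lim_n-\frac1n\sum_{w\in\Sigma_{A,n}}\mu([w])\log\mu([w])$; variance: $\rho_\mu=\lim_n\frac1n\int(\sum_{k=0}^{n-1}f(\sigma^k\mathbf i)-n\int f\,d\mu)^2d\mu(\mathbf i)$. $f$ is cohomologous to a constant if $f=g\circ\sigma-g+c$ for some continuous $g$ and constant $c$. For $\psi:\mathbb N\to\mathbb N$, $\psi^{-1}(n)=\{m\in\mathbb N:\psi(m)=n\}$, $\#$ denotes cardinality, and $R_\psi=\{\mathbf i\in\Sigma_A: d(\sigma^n\mathbf i,\mathbf i)\le K^{-\psi(n)}\text{ for infinitely many }n\}$. *)

(* Defs.v *)
From HB Require Import structures.
From mathcomp Require Import all_boot all_order all_algebra.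
From mathcomp Require Import all_classical all_reals all_analysis.
Set Implicit Arguments. Unset Strict Implicit. Unset Printing Implicit Defensive.
Import Order.TTheory GRing.Theory Num.Theory.
Import numFieldNormedType.Exports.
Local Open Scope classical_set_scope.
Local Open Scope ring_scope.

(* Sequences i = (i_1, i_2, ...) are functions x : nat -> nat, x m = i_(m+1).
   Symbols are the integers 1..K, as in the paper. *)
Definition seqT := nat -> nat.

Definition Sigma (K : nat) : set seqT := [set x | forall m, (1 <= x m <= K)%N].

Definition adm (K : nat) (A : 'M[int]_K) (a b : nat) : bool :=
  [exists i : 'I_K, exists j : 'I_K,
     [&& (i.+1 == a)%N, (j.+1 == b)%N & A i j == 1]].

Definition mxpow (K : nat) (A : 'M[int]_K) (M : nat) : 'M[int]_K :=
  iter M (fun B => B *m A) 1%:M.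

Definition SigmaA (K : nat) (A : 'M[int]_K) : set seqT :=
  [set x | Sigma K x /\ forall l, adm A (x l) (x l.+1)].

Definition sshift (x : seqT) : seqT := fun n => x n.+1.

(* the metric d(i,j) = K^{-|i /\ j|}, |i /\ j| = first index where they differ
   (0-based here, i.e. number of common initial symbols); d = 0 if i = j. *)
Definition sdist (K : nat) {R : realType} (x y : seqT) : R :=
  match pselect (exists n, x n != y n) with
  | left h => ((K%:R : R) ^+ (ex_minn h))^-1
  | right _ => 0
  end.

Definition cyl (w : seq nat) : set seqT :=
  [set x | forall m, (m < size w)%N -> x m = nth 0%N w m].

Definition cylA (K : nat) (A : 'M[int]_K) (w : seq nat) : set seqT :=
  cyl w `&` SigmaA A.

Definition word_restr (x : seqT) (n : nat) : seq nat := [seq x m | m <- iota 0 n].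

Definition wordof (K n : nat) (t : n.-tuple 'I_K) : seq nat :=
  [seq (val i).+1 | i <- t].

Definition word_adm (K : nat) (A : 'M[int]_K) (w : seq nat) : bool :=
  all (fun l => adm A (nth 0%N w l) (nth 0%N w l.+1)) (iota 0 (size w).-1).

(* the measurable structure: sigma-algebra generated by cylinders
   (= product sigma-algebra = Borel sigma-algebra of the metric on Sigma) *)
Definition cylinders : set (set seqT) := range cyl.
Definition SeqSpace := g_sigma_algebraType cylinders.

Definition birk {R : realType} (f : seqT -> R) (n : nat) (x : seqT) : R :=
  \sum_(k < n) f (iter k sshift x).

Definition holder (K : nat) (A : 'M[int]_K) {R : realType} (f : seqT -> R) :=
  exists b : R, exists alpha : R, 0 < b /\ 0 < alpha < 1 /\
    forall x y, SigmaA A x -> SigmaA A y ->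
      forall n, (forall m, (m < n)%N -> x m = y m) ->
        `|f x - f y| <= b * alpha ^+ n.

Definition continuous_on_SigmaA (K : nat) (A : 'M[int]_K) {R : realType}
  (g : seqT -> R) :=
  forall x, SigmaA A x -> forall e : R, 0 < e -> exists2 delta : R, 0 < delta &
    forall y, SigmaA A y -> sdist K x y < delta -> `|g x - g y| < e.

Definition cohom_const (K : nat) (A : 'M[int]_K) {R : realType}
  (f : seqT -> R) :=
  exists (g : seqT -> R) (c : R), continuous_on_SigmaA A g /\
    forall x, SigmaA A x -> f x = g (sshift x) - g x + c.

Definition top_pressure (K : nat) (A : 'M[int]_K) {R : realType} (f : seqT -> R) : R :=
  limn (fun n : nat =>
    ln (\sum_(t : n.-tuple 'I_K | word_adm A (wordof t))
          sup [set expR (birk f n y) | y in cylA A (wordof t)]) / n%:R).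

Definition is_gibbs (K : nat) (A : 'M[int]_K) {R : realType} (f : seqT -> R)
  (mu : probability SeqSpace R) :=
  mu (SigmaA A : set SeqSpace) = 1%E /\
  (forall B : set SeqSpace, measurable B ->
     mu (SigmaA A `&` sshift @^-1` B) = mu B) /\
  (forall B : set SeqSpace, measurable B -> B `<=` SigmaA A ->
     SigmaA A `&` sshift @^-1` B = B -> mu B = 0%E \/ mu B = 1%E) /\
  exists C : R, 1 < C /\ forall x n, SigmaA A x ->
    C^-1 <= fine (mu (cylA A (word_restr x n) : set SeqSpace)) /
            expR (- (n%:R * top_pressure A f) + birk f n x) <= C.

Definition ks_entropy (K : nat) (A : 'M[int]_K) {R : realType}
  (mu : probability SeqSpace R) : R :=
  limn (fun n : nat =>
    - (\sum_(t : n.-tuple 'I_K | word_adm A (wordof t))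
          fine (mu (cylA A (wordof t) : set SeqSpace)) *
          ln (fine (mu (cylA A (wordof t) : set SeqSpace)))) / n%:R).

Definition mu_mean (K : nat) (A : 'M[int]_K) {R : realType}
  (mu : probability SeqSpace R) (f : seqT -> R) : R :=
  fine (\int[mu]_(x in (SigmaA A : set SeqSpace)) (f x)%:E).

Definition asym_variance (K : nat) (A : 'M[int]_K) {R : realType}
  (mu : probability SeqSpace R) (f : seqT -> R) : R :=
  limn (fun n : nat =>
    fine (\int[mu]_(x in (SigmaA A : set SeqSpace))
            ((birk f n x - n%:R * mu_mean A mu f) ^+ 2)%:E) / n%:R).

(* #psi^{-1}(n) as an extended real (psi defined on N = {1,2,...}) *)
Definition npreim (psi : nat -> nat) (n : nat) {R : realType} : \bar R :=
  (\esum_(m in [set m | (0 < m)%N /\ psi m = n]) 1%E).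

Definition Rpsi (K : nat) (A : 'M[int]_K) {R : realType} (psi : nat -> nat)
  : set seqT :=
  [set x | SigmaA A x /\ forall N, exists n, [/\ (N <= n)%N, (0 < n)%N &
     sdist K (iter n sshift x) x <= ((K%:R : R) ^+ psi n)^-1]].

(* Main.v *)
(* The Gibbs inequality makes mu quasi-Bernoulli: up to a constant, the measure of the
   cylinder of a concatenation u v is the product of the measures.  Let w be a word of
   length n and P a finite set of times p >= n + M with #P * mu[w] >= 1, and let Z count
   the p in P at which w occurs again, for points starting with w.  Primitivity gives
   E[Z; w] >= c #P mu[w]^2.  In the second moment, pairs of times at distance j < n
   contribute at most a constant times mu[w]^2 b_j with b_j summable, because cylinders
   shrink exponentially, and the other pairs a constant times mu[w]^3.  Hence a fixed
   proportion of [w] returns to [w] at some time in P.  Almost every point starts with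
   such a word of length n_k for infinitely many k; decomposing a set determined by
   finitely many coordinates according to the first such k shows that the set of points
   with no return from some time on is null. *)
Require Import Defs.
From HB Require Import structures.
From mathcomp Require Import all_boot all_order all_algebra.
From mathcomp Require Import all_classical all_reals all_analysis.
From mathcomp Require Import ring lra zify measurable_realfun.
Set Implicit Arguments. Unset Strict Implicit. Unset Printing Implicit Defensive.
Import Order.TTheory GRing.Theory Num.Theory.
Import numFieldNormedType.Exports.
Local Open Scope classical_set_scope.
Local Open Scope ring_scope.

(** * Sets determined by finitely many coordinates *)

Definition fdep (L : nat) (S : set SeqSpace) :=
  forall x y : seqT, (forall i, (i < L)%N -> x i = y i) -> S x -> S y.

(** A cylinder named by a point on it; taking that point in the subshift makes the word
    admissible. *)
Definition agree (x : seqT) (n : nat) : set SeqSpace :=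
  [set y | forall i, (i < n)%N -> y i = x i].

Lemma iter_sshift n (x : seqT) i : iter n sshift x i = x (n + i)%N.
Proof. by elim: n i => [|n IH] i //; rewrite iterS /sshift IH addnS. Qed.

Lemma cyl_fdep w : fdep (size w) (cyl w).
Proof. by move=> x y e cx i iw; rewrite -e// cx. Qed.

Lemma measurable_cyl w : measurable (cyl w : set SeqSpace).
Proof. by apply: sub_sigma_algebra; exists w. Qed.

Lemma cyl_mkseq (x : seqT) n : cyl (mkseq x n) = agree x n.
Proof.
rewrite /cyl /agree size_mkseq; apply/seteqP; split => y h i ilt;
by move: (h i ilt); rewrite nth_mkseq.
Qed.

(** Symbols range over all of [nat], so infinitely many cylinders may be needed; there are only
    countably many words. *)
Lemma fdep_measurable L S : fdep L S -> measurable S.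
Proof.
move=> dS.
have -> : S = \bigcup_(w in [set w | cyl w `<=` S]) (cyl w : set SeqSpace).
  apply/seteqP; split => [x Sx|x [w]]; last by apply.
  exists (mkseq x L); last by rewrite cyl_mkseq.
  rewrite /= cyl_mkseq => y xy; apply: dS Sx => i iL.
  by rewrite xy.
rewrite bigcup_mkcond.
apply: (@countable_bigcupT_measurable _ _ (seq nat)) => [|w]; first exact: countableP.
by case: ifP => _; [exact: measurable_cyl|exact: measurable0].
Qed.

Lemma fdepW L L' S : (L <= L')%N -> fdep L S -> fdep L' S.
Proof. by move=> LL' dS x y e; apply: dS => i iL; apply: e; exact: leq_trans LL'. Qed.

Lemma fdepI L S T : fdep L S -> fdep L T -> fdep L (S `&` T).
Proof. by move=> dS dT x y e [Sx Tx]; split; [exact: dS Sx|exact: dT Tx]. Qed.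

Lemma fdepC L S : fdep L S -> fdep L (~` S).
Proof. by move=> dS x y e nSx Sy; apply: nSx; apply: dS Sy => i iL; rewrite e. Qed.

Lemma fdep_agree x n : fdep n (agree x n).
Proof. by move=> y z e yx i ilt; rewrite -e// yx. Qed.

Lemma fdep_shift n L S : fdep L S -> fdep (n + L) (iter n sshift @^-1` S).
Proof.
move=> dS x y e; apply: dS => i iL.
by rewrite !iter_sshift e// ltn_add2l.
Qed.

Lemma measurable_agree x n : measurable (agree x n).
Proof. exact: fdep_measurable (@fdep_agree x n). Qed.

Lemma measurable_iter_sshift n (S : set SeqSpace) :
  measurable S -> measurable (iter n sshift @^-1` S : set SeqSpace).
Proof.
have h : measurable_fun setT (iter n sshift : SeqSpace -> SeqSpace).
  apply: (@measurability _ _ SeqSpace SeqSpace setT _ cylinders) => //.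
  move=> _ [_ [w _ <-] <-]; rewrite setTI.
  have : fdep (n + size w) (iter n sshift @^-1` cyl w) by exact: fdep_shift (@cyl_fdep w).
  exact: fdep_measurable.
by move=> mS; rewrite -[X in measurable X]setTI; exact: h.
Qed.

Lemma agree_eq x y n : agree x n y -> agree y n = agree x n.
Proof.
by move=> xy; apply/seteqP; split=> z h i ilt; rewrite h// xy.
Qed.

Lemma agreeS x n k : (n <= k)%N -> agree x k `<=` agree x n.
Proof. by move=> nk y h i ilt; apply: h; exact: leq_trans nk. Qed.

Lemma agree_split x n k :
  agree x (n + k) = agree x n `&` iter n sshift @^-1` agree (iter n sshift x) k.
Proof.
apply/seteqP; split => y /=.
  move=> h; split; first by apply: agreeS h; rewrite leq_addr.
  by move=> i ik; rewrite !iter_sshift h// ltn_add2l.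
move=> [h1 h2] i; case: (ltnP i n) => [/h1//|ni ink].
have := h2 (i - n)%N; rewrite !iter_sshift subnKC//; apply.
by rewrite ltn_subLR.
Qed.

(** * Real-valued probabilities *)

Definition pr {R : realType} (mu : probability SeqSpace R) (B : set SeqSpace) : R :=
  fine (mu B).

Section RealValued.
Variables (R : realType) (mu : probability SeqSpace R).
Local Notation m := (pr mu).

Lemma prE B : measurable B -> mu B = (m B)%:E.
Proof. by move=> mB; rewrite /pr fineK ?fin_num_measure. Qed.

Lemma pr_ge0 B : 0 <= m B.
Proof. exact: fine_ge0. Qed.

Lemma pr0 : m set0 = 0.
Proof. by rewrite /pr measure0. Qed.

Lemma pr_le1 B : measurable B -> m B <= 1.
Proof. by move=> mB; rewrite -lee_fin -prE ?probability_le1. Qed.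

Lemma le_pr A B : measurable A -> measurable B -> A `<=` B -> m A <= m B.
Proof.
by move=> mA mB AB; rewrite -lee_fin -!prE// le_measure ?inE.
Qed.

Lemma prU A B : measurable A -> measurable B -> A `&` B = set0 ->
  m (A `|` B) = m A + m B.
Proof.
move=> mA mB AB; apply/eqP; rewrite -eqe EFinD -!prE ?measureU//.
exact: measurableU.
Qed.

Lemma prDI A B : measurable A -> measurable B -> m A = m (A `\` B) + m (A `&` B).
Proof.
move=> mA mB; rewrite -prU; [|exact: measurableD|exact: measurableI|].
  by rewrite setUC setUIDK.
by apply/seteqP; split=> x // [[_ nB] [_ /nB]].
Qed.

Lemma prC A : measurable A -> m (~` A) = 1 - m A.
Proof.
move=> mA; apply/eqP; rewrite -eqe EFinB -!prE ?probability_setC//.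
exact: measurableC.
Qed.

Lemma pr_nondecreasing_cvg (F : (set SeqSpace)^nat) : (forall i, measurable (F i)) ->
  nondecreasing_seq F -> m (F n) @[n --> \oo] --> m (\bigcup_n F n).
Proof.
move=> mF ndF; have mU : measurable (\bigcup_n F n) by exact: bigcupT_measurable.
rewrite /pr; apply: fine_cvg; rewrite fineK ?fin_num_measure//.
exact: nondecreasing_cvg_mu.
Unshelve. all: by end_near. Qed.

Lemma pr_nonincreasing_cvg (F : (set SeqSpace)^nat) : (forall i, measurable (F i)) ->
  nonincreasing_seq F -> m (F n) @[n --> \oo] --> m (\bigcap_n F n).
Proof.
move=> mF ndF; have mU : measurable (\bigcap_n F n) by exact: bigcapT_measurable.
rewrite /pr; apply: fine_cvg; rewrite fineK ?fin_num_measure//.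
apply: nonincreasing_cvg_mu => //.
by rewrite -ge0_fin_numE ?fin_num_measure.
Unshelve. all: by end_near. Qed.

Lemma integral_wsum (I : Type) (s : seq I) (c : I -> R) (A : I -> set SeqSpace) :
  (forall i, 0 <= c i) -> (forall i, measurable (A i)) ->
  (\int[mu]_x (\sum_(i <- s) (c i * \1_(A i) x)%:E) = (\sum_(i <- s) c i * m (A i))%:E)%E.
Proof.
move=> c0 mA; rewrite ge0_integral_sum//.
- rewrite -sumEFin; apply: eq_bigr => i _.
  under eq_integral do rewrite EFinM.
  rewrite ge0_integralZl//.
  + by rewrite integral_indic// setIT EFinM /pr fineK ?fin_num_measure.
  + by apply/measurable_EFinP; exact: measurable_indic.
  + by rewrite lee_fin.
- move=> i; apply/measurable_EFinP; apply: measurable_funM => //.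
- by move=> i x _; rewrite lee_fin mulr_ge0.
Qed.

(** Integrating an inequality between step functions turns pointwise counting into an inequality
    between measures. *)
Lemma le_wsum (I J : Type) (s : seq I) (t : seq J) (c : I -> R) (d : J -> R)
    (A : I -> set SeqSpace) (B : J -> set SeqSpace) :
  (forall i, 0 <= c i) -> (forall j, 0 <= d j) ->
  (forall i, measurable (A i)) -> (forall j, measurable (B j)) ->
  (forall x, \sum_(i <- s) c i * \1_(A i) x <= \sum_(j <- t) d j * \1_(B j) x) ->
  \sum_(i <- s) c i * m (A i) <= \sum_(j <- t) d j * m (B j).
Proof.
move=> c0 d0 mA mB h; rewrite -lee_fin -!integral_wsum//.
have mS (I' : Type) (s' : seq I') (c' : I' -> R) (A' : I' -> set SeqSpace) :
    (forall i, measurable (A' i)) ->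
    measurable_fun setT (fun x : SeqSpace => \sum_(i <- s') (c' i * \1_(A' i) x)%:E)%E.
  move=> mA'; apply: emeasurable_sum => i.
  apply/measurable_EFinP; apply: measurable_funM => //.
apply: ge0_le_integral => //; [|exact: mS|exact: mS|].
- by move=> x _; rewrite sumEFin lee_fin sumr_ge0// => i _; rewrite mulr_ge0.
- by move=> x _; rewrite !sumEFin lee_fin; exact: h.
Qed.

(* With Z the sum of the indicators of the A p, this is the integral of the
   pointwise inequality 2 l Z <= 1_U + (l Z)^2; optimizing over l gives the usual
   Chung-Erdos lower bound on m U. *)
Lemma chung_erdos (s : seq nat) (A : nat -> set SeqSpace) (U : set SeqSpace) (l : R) :
  (forall p, measurable (A p)) -> measurable U ->
  (forall p, p \in s -> A p `<=` U) -> 0 <= l ->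
  2 * l * (\sum_(p <- s) m (A p)) <=
  m U + l ^+ 2 * (\sum_(p <- s) \sum_(q <- s) m (A p `&` A q)).
Proof.
move=> mA mU AU l0.
pose B (o : option (nat * nat)) := if o is Some (p, q) then A p `&` A q else U.
pose d (o : option (nat * nat)) := if o is Some (p, q) then l ^+ 2 else 1.
have sumE (F : option (nat * nat) -> R) :
    \sum_(o <- None :: [seq Some (p, q) | p <- s, q <- s]) F o =
    F None + \sum_(p <- s) \sum_(q <- s) F (Some (p, q)).
  by rewrite big_cons big_allpairs_dep.
have := @le_wsum _ _ s (None :: [seq Some (p, q) | p <- s, q <- s])
  (fun=> 2 * l) d A B.
rewrite !sumE/= mul1r mulr_sumr mulr_sumr.
under [in X in _ -> _ <= _ + X]eq_bigr do rewrite mulr_sumr.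
apply=> //.
- by move=> _; rewrite mulr_ge0.
- by case=> [[p q]|]//=; rewrite sqr_ge0.
- by case=> [[p q]|]//=; exact: measurableI.
move=> x; rewrite sumE/= mul1r -mulr_sumr.
set Z := \sum_(p <- s) _.
have -> : \sum_(p <- s) \sum_(q <- s) l ^+ 2 * \1_(A p `&` A q) x = (l * Z) ^+ 2.
  rewrite exprMn [Z ^+ 2]expr2 /Z mulr_suml mulr_sumr; apply: eq_bigr => p _.
  by rewrite !mulr_sumr; apply: eq_bigr => q _; rewrite indicI.
have [xU|xU] := pselect (U x).
  have -> : \1_U x = 1 :> R by rewrite indicE mem_set.
  by have := sqr_ge0 (l * Z - 1); nra.
have -> : Z = 0; last by rewrite !mulr0 expr0n addr0.
rewrite /Z big_seq big1// => p ps; rewrite indicE memNset//.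
by move/(AU _ ps).
Qed.

End RealValued.

(** * Quasi-Bernoulli measures *)

Section Mixing.
Variables (R : realType) (mu : probability SeqSpace R) (X : set SeqSpace) (K : nat).
Hypothesis mX : measurable X.
Hypothesis X1 : mu X = 1%E.
Hypothesis XS : forall x, X x -> X (sshift x).
Hypothesis XK : forall x, X x -> forall i, (x i <= K)%N.
Local Notation m := (pr mu).

(** * Decomposition along cylinders, modulo a null set *)

Lemma X_iter n x : X x -> X (iter n sshift x).
Proof. by move=> Xx; elim: n => //= n IH; exact: XS. Qed.

Lemma pr_setIX B : measurable B -> m (B `&` X) = m B.
Proof.
move=> mB; rewrite (prDI mu mB mX) [m (_ `\` _)](_ : _ = 0) ?add0r//.
apply/eqP; rewrite eq_le pr_ge0 andbT.
have <- : m (~` X) = 0 by rewrite prC// /pr X1 subrr.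
by apply: le_pr; [exact: measurableD|exact: measurableC|move=> x []].
Qed.

Lemma le_prX A B : measurable A -> measurable B -> A `&` X `<=` B -> m A <= m B.
Proof.
by move=> mA mB AB; rewrite -pr_setIX//; apply: le_pr => //; exact: measurableI.
Qed.

Lemma prX_eq0 A : measurable A -> A `&` X = set0 -> m A = 0.
Proof. by move=> mA AX; rewrite -pr_setIX// AX pr0. Qed.

(** Words as finite functions form a finite index type; letters of points of [X] are at most [K]. *)
Definition cylf L (t : {ffun 'I_L -> 'I_K.+1}) : set SeqSpace :=
  [set y : SeqSpace | forall i : 'I_L, y i = t i].

Lemma cylfE L (t : {ffun 'I_L -> 'I_K.+1}) y : cylf t y -> cylf t = agree y L.
Proof.
move=> ty; apply/seteqP; split => z tz.
  by move=> i iL; rewrite (tz (Ordinal iL)) (ty (Ordinal iL)).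
by move=> i; rewrite tz// -ty.
Qed.

Lemma measurable_cylf L (t : {ffun 'I_L -> 'I_K.+1}) : measurable (cylf t).
Proof.
apply: (@fdep_measurable L) => x y e tx i.
by rewrite -e.
Qed.

Lemma pr_split L n S : measurable S ->
  m S = \sum_(t : {ffun 'I_L -> 'I_K.+1}) m (S `&` iter n sshift @^-1` cylf t).
Proof.
move=> mS; have mF t : measurable (S `&` iter n sshift @^-1` cylf t).
  by apply: measurableI => //; apply: measurable_iter_sshift; exact: measurable_cylf.
pose F (t : {ffun 'I_L -> 'I_K.+1}) : set SeqSpace := S `&` iter n sshift @^-1` cylf t.
have -> : m S = m (\bigcup_(t in [set: {ffun 'I_L -> 'I_K.+1}]) F t).
  have mU : measurable (\bigcup_(t in [set: {ffun 'I_L -> 'I_K.+1}]) F t).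
    by apply: fin_bigcup_measurable => // t _; exact: mF.
  apply/eqP; rewrite eq_le; apply/andP; split; last first.
    by apply: le_pr => // x [t _ []].
  apply: le_prX => // x [Sx Xx].
  exists [ffun i : 'I_L => inord (iter n sshift x i)] => //; split=> //= i.
  by rewrite ffunE inordK// ltnS; apply: XK; exact: X_iter.
apply/eqP; rewrite -eqe -sumEFin -prE; last first.
  by apply: fin_bigcup_measurable => // t _; exact: mF.
rewrite measure_fin_bigcup//.
- have -> : [set: {ffun 'I_L -> 'I_K.+1}] = [set` index_enum {ffun 'I_L -> 'I_K.+1}].
    by apply/seteqP; split=> t //= _; rewrite mem_index_enum.
  rewrite -fsbig_seq ?index_enum_uniq//; apply/eqP/eq_bigr => t _.
  by rewrite /pr fineK ?fin_num_measure//; exact: mF.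
- exact: finite_finset.
- move=> s t _ _ [x [[_ sx] [_ tx]]].
  by apply/ffunP => i; apply/val_inj; rewrite -[LHS]sx -[RHS]tx.
- by move=> t _; exact: mF.
Qed.

(** Sum over the words read at times [n1] and [n2]. A word that no point of [X] realizes contributes
    zero on both sides. *)
Lemma compare_shifted_cylinders L (c1 c2 : R) n1 n2 (S T : set SeqSpace) :
  measurable S -> measurable T ->
  (forall y, X y -> c1 * m (S `&` iter n1 sshift @^-1` agree y L) <=
                    c2 * m (T `&` iter n2 sshift @^-1` agree y L)) ->
  c1 * m S <= c2 * m T.
Proof.
move=> mS mT h; rewrite (@pr_split L n1 S)// (@pr_split L n2 T)// !mulr_sumr.
apply: ler_sum => t _.
have [|/set0P [y [ty Xy]]] := eqVneq (cylf t `&` X) set0; last first.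
  by rewrite (cylfE ty); exact: h.
move=> tX.
have null n (V : set SeqSpace) : measurable V -> m (V `&` iter n sshift @^-1` cylf t) = 0.
  move=> mV; apply: prX_eq0.
    by apply: measurableI => //; apply: measurable_iter_sshift; exact: measurable_cylf.
  rewrite -subset0 => x [[_ tx] Xx].
  have : (cylf t `&` X) (iter n sshift x) by split; [exact: tx|exact: X_iter].
  by rewrite tX.
by rewrite !null ?mulr0.
Qed.

Lemma compare_cylinders L (c1 c2 : R) (S T : set SeqSpace) : measurable S -> measurable T ->
  (forall y, X y -> c1 * m (S `&` agree y L) <= c2 * m (T `&` agree y L)) ->
  c1 * m S <= c2 * m T.
Proof. exact: (@compare_shifted_cylinders L c1 c2 0 0). Qed.

(** * Quasi-Bernoulli estimates for an invariant measure *)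

Hypothesis inv1 : forall B : set SeqSpace, measurable B -> mu (sshift @^-1` B) = mu B.

Lemma pr_shift n (B : set SeqSpace) : measurable B -> m (iter n sshift @^-1` B) = m B.
Proof.
elim: n => [|n IH] mB //.
rewrite -IH// [in RHS]/pr -inv1; last exact: measurable_iter_sshift.
congr (pr mu _); apply/seteqP; split => x /=; by rewrite -iterSr.
Qed.

Variable Q : R.
Hypothesis Q1 : 1 <= Q.
Hypothesis QBu : forall x n k, X x ->
  m (agree x (n + k)) <= Q * (m (agree x n) * m (agree (iter n sshift x) k)).
Hypothesis QBl : forall x n k, X x ->
  m (agree x n) * m (agree (iter n sshift x) k) <= Q * m (agree x (n + k)).
Hypothesis low : forall k, exists2 c : R, 0 < c & forall x, X x -> c <= m (agree x k).
Variable M : nat.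
Hypothesis M0 : (0 < M)%N.
(** The last prescribed letter of [x] is at position [q] and [z] starts [M] steps later, so [M - 1]
    letters are free in between. *)
Hypothesis connect : forall x z q, X x -> X z ->
  exists y, [/\ X y, agree x q.+1 y & iter (q + M) sshift y = z].
Hypothesis two : forall a : nat, exists2 z, X z & z 0%N != a.

Let Q0 : 0 < Q. Proof. exact: lt_le_trans ltr01 Q1. Qed.
Let magree := measurable_agree.
#[local] Hint Resolve magree : core.
#[local] Hint Extern 0 (is_true (0 <= pr _ _)) => exact: pr_ge0 : core.

(** Seen from time [n], the event depends on finitely many letters. [QBu] applies on each cylinder
    of that length, and invariance removes the delay [p - n]. *)
Lemma quasi_indep_le x n p L B : X x -> (n <= p)%N -> fdep L B ->
  m (agree x n `&` iter p sshift @^-1` B) <= Q * m (agree x n) * m B.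
Proof.
move=> Xx np dB; have mB := fdep_measurable dB.
set S := _ `&` _; have mS : measurable S.
  by apply: measurableI => //; exact: measurable_iter_sshift.
rewrite -[m S]mul1r -(pr_shift (p - n) mB).
set B' : set SeqSpace := iter (p - n) sshift @^-1` B.
have dB' : fdep (p - n + L) B' by exact: fdep_shift dB.
have SE : S = agree x n `&` iter n sshift @^-1` B'.
  by rewrite /S /B'; congr (_ `&` _); apply/seteqP; split => y /=; rewrite -iterD subnK.
apply: (@compare_shifted_cylinders (p - n + L) 1 (Q * m (agree x n)) n 0) => //.
  exact: measurable_iter_sshift.
move=> y Xy; rewrite mul1r /=.
set l := (p - n + L)%N in dB' *; set T := S `&` _.
have mT : measurable T.
  by apply: measurableI => //; apply: measurable_iter_sshift; exact: magree.
have rhs0 : 0 <= Q * m (agree x n) * m (B' `&` agree y l).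
  exact: mulr_ge0 (mulr_ge0 (ltW Q0) (pr_ge0 _ _)) (pr_ge0 _ _).
have [/(prX_eq0 mT)->//|/set0P [z [[Sz Vz] Xz]]] := eqVneq (T `&` X) set0.
move: (Sz); rewrite SE => -[xz Bz].
have -> : B' `&` agree y l = agree (iter n sshift z) l.
  rewrite (agree_eq Vz) setIidr// => w yw; apply: dB' Bz => i il.
  by rewrite yw// Vz.
rewrite -(agree_eq xz); apply: le_trans (_ : m (agree z (n + l)) <= _).
  apply: le_pr => // w [Sw Vw]; rewrite agree_split (agree_eq xz) (agree_eq Vz).
  by move: Sw; rewrite SE => -[].
by rewrite -mulrA; exact: QBu.
Qed.

(** * Mixing and exponential decay of cylinders *)

Lemma mixing_ge : exists2 c : R, 0 < c & forall x z q n, X x -> X z ->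
  c * (m (agree x q.+1) * m (agree z n)) <=
  m (agree x q.+1 `&` iter (q + M) sshift @^-1` agree z n).
Proof.
have [c c0 lowc] := low M.-1.
exists (c / Q ^+ 2); first by rewrite divr_gt0 ?exprn_gt0.
(* The word of [y] is that of [x], then [M - 1] connecting letters, then that of [z]. Two uses of
   [QBl] cost [Q ^+ 2]; the middle factor is at least [c]. *)
move=> x z q n Xx Xz; have [y [Xy xy yz]] := connect q Xx Xz.
have le1 : m (agree y (q + M + n)) <=
    m (agree x q.+1 `&` iter (q + M) sshift @^-1` agree z n).
  apply: le_pr => //.
    by apply: measurableI => //; exact: measurable_iter_sshift.
  move=> w; rewrite agree_split yz => -[yw zw]; split=> //.
  rewrite -(agree_eq xy); apply: agreeS yw.
  by rewrite -addn1 leq_add2l.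
have le2 := QBl (q + M) n Xy; rewrite yz in le2.
have le3 := QBl q.+1 M.-1 Xy; rewrite addSnnS prednK// (agree_eq xy) in le3.
have le4 := lowc _ (X_iter q.+1 Xy).
apply: le_trans le1.
rewrite mulrAC ler_pdivrMr ?exprn_gt0// [leRHS]mulrC expr2.
apply: le_trans (_ : Q * (m (agree y (q + M)) * m (agree z n)) <= _); last first.
  by rewrite -mulrA ler_pM2l.
rewrite !mulrA ler_wpM2r//; apply: le_trans le3.
by rewrite mulrC ler_wpM2l.
Qed.

(* At time q + M some letter other than x (q + M) is possible, and by [mixing_ge] it
   carries a fixed proportion of the cylinder. *)
Lemma exp_decay : exists2 theta : R, 0 < theta < 1 & forall x q, X x ->
  m (agree x (q.+1 + M)) <= theta * m (agree x q.+1).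
Proof.
have [c c0 hc] := mixing_ge; have [d d0 lowd] := low 1.
(* Capping at one half keeps [1 - e] positive. *)
pose e := Num.min (c * d) 2^-1.
have e0 : 0 < e by rewrite lt_min mulr_gt0//=.
have e2 : e <= 2^-1 by rewrite ge_min lexx orbT.
exists (1 - e); first by apply/andP; split; lra.
move=> x q Xx; have [z Xz zx] := two (x (q + M)%N).
have := hc x z q 1%N Xx Xz.
set V := _ `&` _ => hV.
have mV : measurable V by apply: measurableI => //; exact: measurable_iter_sshift.
have : m (agree x (q.+1 + M) `|` V) <= m (agree x q.+1).
  apply: le_pr => //; first exact: measurableU.
  by move=> w [|[]//]; apply: agreeS; rewrite leq_addr.
rewrite prU//; last first.
  rewrite -subset0 => w [xw [_ zw]]; move: zx; rewrite -(zw 0%N)// iter_sshift.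
  by rewrite addn0 xw ?eqxx.
move=> h; rewrite mulrBl mul1r.
have : e * m (agree x q.+1) <= m V.
  apply: le_trans hV; rewrite [_ * m (agree z 1)]mulrC mulrA ler_wpM2r//.
  by rewrite ge_min ler_wpM2l ?lowd ?(ltW c0).
by move: h; lra.
Qed.

Lemma agree_summable : exists (b : nat -> R) (Sb : R), [/\ forall j, 0 <= b j,
  forall x j, X x -> m (agree x j) <= b j & forall n, \sum_(j < n) b j <= Sb].
Proof.
have [theta /andP[t0 t1] decay] := exp_decay.
have decay_iter x k q : X x -> m (agree x (q.+1 + k * M)) <= theta ^+ k.
  move=> Xx; elim: k => [|k IH]; first by rewrite expr0; exact: pr_le1.
  rewrite mulSn addnCA [X in agree _ X]addnC addSn -addSn exprS.
  apply: le_trans (decay _ _ Xx) _.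
  by rewrite ler_wpM2l// ltW.
(* [exp_decay] gains a factor [theta] per [M] letters, but only after a first letter, hence the
   predecessor. *)
pose b j : R := theta ^+ (j.-1 %/ M).
have b0 j : 0 <= b j by rewrite exprn_ge0// ltW.
have b1 j : b j <= 1 by rewrite exprn_ile1 ?ltW.
exists b, (M.+1%:R / (1 - theta)); split=> //.
  move=> x [|j] Xx; first by rewrite /b div0n expr0; exact: pr_le1.
  rewrite [in X in m X](divn_eq j M) addnC -addSn; exact: decay_iter.
(* The partial sum is at most [M + 1] plus [theta] times itself. The first [M + 1] terms are split
   off because the recursion [b (M + j) = theta * b j] holds only from [j = 1] on. *)
move=> n; rewrite ler_pdivlMr ?subr_gt0// mulrBr mulr1 lerBlDr.
have leT k l : (k <= l)%N -> \sum_(j < k) b j <= \sum_(j < l) b j.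
  move=> kl; rewrite -(subnKC kl) big_split_ord/= lerDl.
  by apply: sumr_ge0.
have leM k : \sum_(j < k) b j <= k%:R.
  apply: le_trans (_ : \sum_(j < k) (1 : R) <= _); first exact: ler_sum.
  by rewrite sumr_const card_ord.
have T0 k : 0 <= \sum_(j < k) b j by apply: sumr_ge0.
have [nM|Mn] := leqP n M.+1.
  apply: le_trans (_ : n%:R <= _) => //.
  by rewrite -[leLHS]addr0 lerD ?ler_nat// mulr_ge0// ltW.
have splitn : \sum_(j < n) b j =
    \sum_(j < M.+1) b j + \sum_(j < n - M.+1) b (M.+1 + j)%N.
  by rewrite -[in LHS](subnKC (ltnW Mn)) big_split_ord.
rewrite [leLHS]splitn lerD//.
have -> : \sum_(i < n - M.+1) b (M.+1 + i)%N = theta * \sum_(i < n - M.+1) b i.+1.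
  rewrite mulr_sumr; apply: eq_bigr => i _; rewrite /b addSn/=.
  by rewrite divnDl ?dvdnn// divnn M0 exprS.
rewrite mulrC ler_wpM2r ?(ltW t0)//.
apply: le_trans (leT (n - M.+1).+1 n _); last by lia.
by rewrite big_ord_recl lerDr.
Qed.

(** With truncated subtraction one of the two differences is zero, so their sum is the distance from
    [p] to [q]; each distance occurs at most twice, once on either side of [p]. *)
Lemma sum_dist_le (b : nat -> R) Sb (s : seq nat) p :
  (forall j, 0 <= b j) -> (forall n, \sum_(j < n) b j <= Sb) -> uniq s ->
  \sum_(q <- s) b ((p - q) + (q - p))%N <= 2 * Sb.
Proof.
move=> b0 bS us; pose F q := b ((p - q) + (q - p))%N.
pose N := (\max_(q <- s) q).+1.
have sN q : q \in s -> (q < p + N)%N.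
  move=> qs; rewrite ltn_addl// ltnS.
  by rewrite (big_rem q)//= leq_maxl.
have -> : \sum_(q <- s) F q = \sum_(q <- iota 0 (p + N) | q \in s) F q.
  have ps : perm_eq s [seq q <- iota 0 (p + N) | q \in s].
    apply: uniq_perm => //; first by rewrite filter_uniq// iota_uniq.
    by move=> q; rewrite mem_filter mem_iota/= add0n; case: (boolP (q \in s)) => //= /sN.
  by rewrite -[RHS]big_filter (perm_big _ ps).
apply: le_trans (_ : \sum_(q <- iota 0 (p + N)) F q <= _).
  rewrite [leRHS](bigID (mem s))/= lerDl; apply: sumr_ge0 => i _; exact: b0.
have -> : iota 0 (p + N) = index_iota 0 (p + N) by rewrite /index_iota subn0.
rewrite big_mkord big_split_ord/= mulr2n mulrDl mul1r.
apply: lerD; last first.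
  rewrite (eq_bigr (fun i : 'I_N => b i)) => [|i _]; first exact: bS.
  by rewrite /F addKn subnDA subnn.
rewrite (reindex_inj rev_ord_inj)/=.
apply: le_trans (bS p.+1); rewrite big_ord_recl.
rewrite (eq_bigr (fun i : 'I_p => b i.+1)) => [|i _]; first by rewrite lerDr.
rewrite /F subKn ?ltn_ord//; congr b.
by rewrite (eqP (leq_subr _ _ : _ - _ == 0)%N) addn0.
Qed.

(** * Moments of the number of recurrences of a word *)

Let self_hit x n p : set SeqSpace :=
  agree x n `&` iter p sshift @^-1` agree x n.

Lemma measurable_self_hit x n p : measurable (self_hit x n p).
Proof. by apply: measurableI => //; exact: measurable_iter_sshift. Qed.

(** Fix the letters up to time [p - M]: after each such prefix, [mixing_ge] puts the word at time
    [p] with proportion at least [c] times its measure. *)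
Lemma self_hit_ge : exists2 c : R, 0 < c & forall x n p, X x -> (n + M <= p)%N ->
  c * m (agree x n) ^+ 2 <= m (self_hit x n p).
Proof.
have [c c0 mix] := mixing_ge; exists c => // x n p Xx nMp.
rewrite expr2 mulrA -[leRHS]mul1r.
apply: (@compare_cylinders (p - M).+1) => //; first exact: measurable_self_hit.
move=> y Xy; rewrite mul1r.
have nq : (n <= (p - M).+1)%N by lia.
have [xy|xy] := pselect (agree x n y); last first.
  rewrite (_ : agree x n `&` _ = set0) ?pr0 ?mulr0//.
  rewrite -subset0 => w [xw yw]; apply: xy => i il.
  by rewrite -xw// yw// (leq_trans il).
have sub : agree y (p - M).+1 `<=` agree x n.
  by rewrite -(agree_eq xy); exact: agreeS.
rewrite (setIidr sub) /self_hit setIAC (setIidr sub).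
have := mix _ _ (p - M)%N n Xy Xx; rewrite subnK; last by lia.
by apply: le_trans; rewrite -mulrA ler_pM2l// mulrC.
Qed.

(* When j < n, the two occurrences of the word overlap and together force a word of
   length n + j, so the missing factor is the measure of a cylinder of length j; this
   is summable in j by [agree_summable]. *)
Lemma self_hit_le x n j b : X x -> 0 <= b -> (forall z, X z -> m (agree z j) <= b) ->
  m (self_hit x n j) <= Q * m (agree x n) * (b + m (agree x n)).
Proof.
move=> Xx b0 bP; set a := m (agree x n).
have a0 : 0 <= a by exact: pr_ge0.
have [nj|jn] := leqP n j.
  apply: le_trans (quasi_indep_le Xx nj (@fdep_agree x n)) _.
  by rewrite ler_wpM2l ?lerDr// mulr_ge0// ltW.
have mS := measurable_self_hit x n j.
have rhs0 : 0 <= Q * a * (b + a) by rewrite !mulr_ge0 ?addr_ge0// ltW.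
have [/(prX_eq0 mS)->//|/set0P [z [[xz jz] Xz]]] := eqVneq (self_hit x n j `&` X) set0.
apply: le_trans (_ : m (agree z (n + j)) <= _).
  apply: le_pr => // w [xw jw] i il.
  have [iN|Ni] := ltnP i n; first by rewrite xw// xz.
  have ij : (i - j < n)%N by lia.
  have := jw _ ij; have := jz _ ij; rewrite !iter_sshift subnKC; last by lia.
  by move=> -> ->.
apply: le_trans (QBu n j Xz) _; rewrite (agree_eq xz) -mulrA ler_pM2l//.
rewrite ler_wpM2l//; apply: le_trans (bP _ (X_iter n Xz)) _.
by rewrite lerDl.
Qed.

(** For [p <= q], the occurrences at [p] and [q] form, seen from time [p], a self-hit with gap
    [q - p]. [quasi_indep_le] separates it from the occurrence at time 0, and [self_hit_le] bounds
    it. *)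
Lemma self_hit2_le x n p q b : X x -> (n <= p)%N -> (n <= q)%N ->
  0 <= b -> (forall z, X z -> m (agree z (p - q + (q - p))%N) <= b) ->
  m (self_hit x n p `&` self_hit x n q) <=
  Q ^+ 2 * m (agree x n) ^+ 2 * (b + m (agree x n)).
Proof.
wlog pq : p q / (p <= q)%N.
  move=> W; case: (leqP p q) => [|/ltnW qp] Xx np nq b0 bP; first by move/W; apply.
  by rewrite setIC; apply: W => //; rewrite addnC.
move=> Xx np nq b0; rewrite (eqP (pq : p - q == 0)%N) add0n => bP.
have dB : fdep (q - p + n) (self_hit x n (q - p)).
  apply: fdepI; first by apply: fdepW (@fdep_agree x n); rewrite leq_addl.
  exact: fdep_shift (@fdep_agree x n).
apply: le_trans (_ : m (agree x n `&` iter p sshift @^-1` self_hit x n (q - p)) <= _).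
  apply: le_pr.
  - by apply: measurableI; exact: measurable_self_hit.
  - by apply: measurableI => //; apply: measurable_iter_sshift; exact: measurable_self_hit.
  move=> w [[xw pw] [_ qw]]; split => //; split => //=.
  by rewrite -iterD subnK.
apply: le_trans (quasi_indep_le Xx np dB) _.
have := self_hit_le n Xx b0 bP => h.
rewrite !expr2 -!mulrA ler_pM2l//.
rewrite [leRHS]mulrCA ler_wpM2l//.
by rewrite mulrA.
Qed.

(** Each point is compared with its own beginning; within [agree x n] this is the union of the
    [self_hit x n p] for [p] in [s]. *)
Definition returns (s : seq nat) n : set SeqSpace :=
  [set y | exists2 p, p \in s & agree y n (iter p sshift y)].

Lemma fdep_returns s n : fdep (\max_(p <- s) p + n) (returns s n).
Proof.
move=> y z e [p ps py]; exists p => // i il.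
have pm : (p <= \max_(p <- s) p)%N by rewrite (big_rem p)//= leq_maxl.
have := py i il; rewrite !iter_sshift !e//; first by rewrite ltn_addl.
by rewrite -addnS leq_add.
Qed.

(** Second moment method: for a cylinder of measure [a] and [N] times, the first moment is at least
    [c N a^2] and the second at most [Q^2 T N^2 a^3]; the square of the former over the latter is a
    fixed multiple of [a]. *)
Lemma return_probability : exists2 c : R, 0 < c & forall x n s, X x -> uniq s ->
  (forall p, p \in s -> (n + M <= p)%N) -> 1 <= (size s)%:R * m (agree x n) ->
  c * m (agree x n) <= m (agree x n `&` returns s n).
Proof.
have [c c0 hge] := self_hit_ge.
have [b [Sb [b0 bP bS]]] := agree_summable.
have Sb0 : 0 <= Sb by have := bS 0%N; rewrite big_ord0.
pose T := 2 * Sb + 1; have T0 : 0 < T by rewrite /T; lra.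
have D0 : 0 < Q ^+ 2 * T by rewrite mulr_gt0// exprn_gt0.
exists (c ^+ 2 / (Q ^+ 2 * T)); first by rewrite divr_gt0// exprn_gt0.
move=> x n s Xx us sn; set a := m (agree x n); set N : R := (size s)%:R => Na.
have ns p : p \in s -> (n <= p)%N by move/sn; apply: leq_trans; rewrite leq_addr.
have a0 : 0 <= a by exact: pr_ge0.
have N0 : 0 <= N by [].
have Na0 : 0 < N * a by lra.
(* The first moment bound divided by the second moment bound, which is the optimal parameter for
   these bounds in [chung_erdos]. *)
pose l := c / (Q ^+ 2 * T) / (N * a).
have l0 : 0 <= l by rewrite !divr_ge0// ltW.
set U := _ `&` _.
have mU : measurable U.
  by apply: measurableI => //; apply: fdep_measurable; exact: fdep_returns.
have := @chung_erdos _ mu s (self_hit x n) U l (measurable_self_hit x n) mU.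
have sU p : p \in s -> self_hit x n p `<=` U.
  move=> ps w [xw pw]; split => //; exists p => // i il.
  by rewrite pw// xw.
move=> /(_ sU l0) ce.
have sum_const (d : R) : \sum_(p <- s) d = N * d.
  by rewrite big_const_seq count_predT iter_addr_0 mulr_natl.
have first_moment : N * (c * a ^+ 2) <= \sum_(p <- s) m (self_hit x n p).
  rewrite -sum_const big_seq [leRHS]big_seq; apply: ler_sum => p /sn; exact: hge.
have second_moment : \sum_(p <- s) \sum_(q <- s) m (self_hit x n p `&` self_hit x n q)
    <= Q ^+ 2 * a ^+ 2 * (N * (2 * Sb + N * a)).
  rewrite -sum_const mulr_sumr big_seq [leRHS]big_seq.
  apply: ler_sum => p ps; rewrite -sum_const.
  apply: le_trans (_ : Q ^+ 2 * a ^+ 2 *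
      (\sum_(q <- s) b (p - q + (q - p))%N + \sum_(q <- s) a) <= _).
    rewrite -big_split mulr_sumr big_seq [leRHS]big_seq; apply: ler_sum => q qs.
    apply: self_hit2_le => //; [exact: ns|exact: ns|by move=> z; exact: bP].
  rewrite ler_wpM2l ?mulr_ge0 ?exprn_ge0 ?(ltW Q0)// lerD2r.
  exact: sum_dist_le.
have e1 : l * (N * a) = c / (Q ^+ 2 * T) by rewrite /l divfK// gt_eqF.
have e2 : Q ^+ 2 * T * (l * (N * a)) = c by rewrite e1 mulrC divfK// gt_eqF.
have -> : c ^+ 2 / (Q ^+ 2 * T) * a = 2 * l * (N * (c * a ^+ 2)) - l * c * N * a ^+ 2.
  transitivity (l * (N * a) * c * a); last by ring.
  by rewrite e1; ring.
rewrite lerBlDr.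
apply: le_trans (ler_wpM2l _ first_moment) _; first by rewrite mulr_ge0.
apply: le_trans ce _; rewrite lerD2l.
apply: le_trans (ler_wpM2l (sqr_ge0 l) second_moment) _.
(* Since [1 <= N * a], the term [2 * Sb] is absorbed into a multiple of [N * a]. *)
apply: le_trans (_ : l ^+ 2 * (Q ^+ 2 * a ^+ 2 * (N * (N * a * T))) <= _).
  rewrite ler_wpM2l ?sqr_ge0// ler_wpM2l ?mulr_ge0 ?exprn_ge0 ?(ltW Q0)//.
  rewrite ler_wpM2l// /T mulrDr mulr1 lerD2r.
  by rewrite -[leLHS]mul1r ler_wpM2r// mulr_ge0.
by rewrite -[in leRHS]e2 le_eqVlt; apply/orP; left; apply/eqP; ring.
Qed.

(** * From a fixed proportion to almost every point *)

Lemma strictly_increasing_ge (u : nat -> nat) :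
  (forall k, (u k < u k.+1)%N) -> forall k, (k <= u k)%N.
Proof. by move=> uS; elim=> // k IH; exact: leq_ltn_trans IH (uS k). Qed.

Definition io (E : nat -> set SeqSpace) : set SeqSpace :=
  [set x | forall N, exists k, (N <= k)%N /\ E k x].

Lemma ioE E : io E = \bigcap_N \bigcup_k E (N + k)%N.
Proof.
apply/seteqP; split => x h N => [_|].
  by have [k [Nk Ek]] := h N; exists (k - N)%N => //; rewrite subnKC.
by have [k _ Ek] := h N I; exists (N + k)%N; rewrite leq_addr.
Qed.

Lemma measurable_io E : (forall k, measurable (E k)) -> measurable (io E).
Proof.
by move=> mE; rewrite ioE; apply: bigcapT_measurable => N; exact: bigcupT_measurable.
Qed.

(* If B, the set of points with no hit from time N on, had positive measure, then
   approximate it from outside by F j, the points with no hit among the first j times,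
   which depends on finitely many coordinates.  Stopping at the first late k for which
   E k holds cuts almost all of F j into cylinders, each of which meets the complement of
   B in proportion at least c; but m (F j `\` B) tends to 0. *)
Lemma infinitely_often (E H : nat -> set SeqSpace) (nk d : nat -> nat) (c : R) :
  (forall k, (nk k < nk k.+1)%N) -> 0 < c ->
  (forall k, fdep (nk k) (E k)) -> (forall k, fdep (d k) (H k)) ->
  (forall k x, X x -> E k x ->
    c * m (agree x (nk k)) <= m (agree x (nk k) `&` H k)) ->
  m (io E) = 1 ->
  m (io H) = 1.
Proof.
move=> nkS c0 dE dH hit Eio.
have nkmono : {homo nk : i j / (i <= j)%N}.
  by apply: homo_leq => // [|i]; [exact: leq_trans|exact: ltnW].
have nk_ge := strictly_increasing_ge nkS.
pose hitfrom N : set SeqSpace := \bigcup_k H (N + k)%N.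
have mH N : measurable (hitfrom N).
  by apply: bigcupT_measurable => k; exact: fdep_measurable (@dH _).
pose F N j : set SeqSpace := [set x | forall k, (k < j)%N -> ~ H (N + k)%N x].
have dF N j : fdep (\max_(k < j) d (N + k)%N) (F N j).
  move=> x y e Fx k kj Hy; apply: (Fx k kj); apply: dH Hy => i il; rewrite e//.
  by apply: leq_trans il _; exact: (leq_bigmax (Ordinal kj)).
have mF N j : measurable (F N j) by exact: fdep_measurable (@dF _ _).
have step N j : c * m (F N j) <= m (F N j `&` hitfrom N).
  (* For [k] at least [l0], the first [nk k] letters decide [F N j], and a hit at [k] counts for
     [hitfrom N]. *)
  set D := \max_(k < j) d (N + k)%N; pose l0 := maxn N D.
  pose G l : set SeqSpace := [set x | exists2 k, (l0 <= k < l0 + l)%N & E k x].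
  have dG l : fdep (nk (l0 + l)%N) (G l).
    move=> x y e [k /andP[kl lk] Ex]; exists k; first by rewrite kl.
    by apply: dE Ex => i il; apply: e; apply: leq_trans il _; apply/nkmono/ltnW.
  have mG l : measurable (G l) by exact: fdep_measurable (@dG _).
  have stopped l : c * m (F N j `&` G l) <= m (F N j `&` G l `&` hitfrom N).
    elim: l => [|l IH].
      rewrite (_ : G 0%N = set0) ?setI0 ?set0I ?pr0 ?mulr0//.
      rewrite -subset0 => x [k /andP[kl lk] _].
      by move: (leq_ltn_trans kl lk); rewrite addn0 ltnn.
    (* The points of [F N j] whose first late index is [l0 + l]: a union of cylinders of length
       [nk (l0 + l)], and [hit] applies on each that meets [X]. *)
    pose V : set SeqSpace := F N j `&` E (l0 + l)%N `&` ~` G l.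
    have dV : fdep (nk (l0 + l)%N) V.
      apply: fdepI; last exact: fdepC.
      apply: fdepI; last exact: dE.
      apply: fdepW (@dF N j); apply: leq_trans (nk_ge _).
      by rewrite (leq_trans _ (leq_addr _ _))// leq_maxr.
    have mV := fdep_measurable dV.
    have FG : F N j `&` G l.+1 = F N j `&` G l `|` V.
      apply/seteqP; split => x.
        move=> [Fx [k /andP[kl lk] Ex]].
        have [Gx|nGx] := pselect (G l x); [by left|right].
        split => //; split => //.
        move: lk; rewrite addnS ltnS leq_eqVlt => /orP[/eqP <-//|kl'].
        by exfalso; apply: nGx; exists k => //; rewrite kl.
      move=> [[Fx [k /andP[kl lk] Ex]]|[[Fx Ex] _]]; split => //.
        by exists k => //; rewrite kl addnS ltnW.
      by exists (l0 + l)%N => //; rewrite leq_addr addnS ltnS leqnn.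
    have disj : (F N j `&` G l) `&` V = set0.
      by rewrite -subset0 => x [[_ Gx] [_ /(_ Gx)]].
    rewrite FG setIUl !prU//; last 4 first.
    - by apply: measurableI => //; exact: measurableI.
    - exact: measurableI.
    - by rewrite setIACA disj set0I.
    - exact: measurableI.
    rewrite mulrDr lerD// -[leRHS]mul1r.
    apply: (@compare_cylinders (nk (l0 + l)%N)) => //; first exact: measurableI.
    move=> y Xy; rewrite mul1r.
    have [Vy|Vy] := pselect (V y); last first.
      rewrite (_ : V `&` agree y _ = set0) ?pr0 ?mulr0//.
      rewrite -subset0 => w [Vw yw]; apply: Vy; apply: dV Vw => i il.
      by rewrite yw.
    have Vsub : agree y (nk (l0 + l)%N) `<=` V.
      by move=> w yw; apply: dV Vy => i il; rewrite yw.
    rewrite (setIidr Vsub) setIAC (setIidr Vsub).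
    have [[_ Ey] _] := Vy.
    apply: le_trans (hit _ _ Xy Ey) _.
    have mHl : measurable (H (l0 + l)%N) by exact: fdep_measurable (@dH _).
    apply: le_pr; [exact: measurableI|exact: measurableI|].
    move=> w [yw Hw]; split => //; exists (l0 + l - N)%N => //.
    by rewrite subnKC// (leq_trans _ (leq_addr _ _))// leq_maxl.
  have Gfull : m (F N j) <= m (\bigcup_l (F N j `&` G l)).
    have mU : measurable (\bigcup_l (F N j `&` G l)).
      by apply: bigcupT_measurable => l; exact: measurableI.
    rewrite -setI_bigcupr in mU *.
    have mGG : measurable (\bigcup_l G l) by exact: bigcupT_measurable.
    rewrite [leLHS](prDI mu (mF N j) mGG) gerDr.
    have mEio : measurable (io E).
      by apply: measurable_io => k; exact: fdep_measurable (@dE _).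
    have <- : m (~` (io E)) = 0.
      by rewrite prC// Eio subrr.
    apply: le_pr; [exact: measurableD|exact: measurableC|].
    move=> x [Fx nG] Ex; apply: nG; have [k [kl Ek]] := Ex l0.
    exists (k - l0).+1 => //; exists k => //; apply/andP; split; first exact: kl.
    by rewrite addnS ltnS subnKC; [|exact: kl].
  apply: le_trans (ler_wpM2l (ltW c0) Gfull) _; rewrite -ler_pdivlMl//.
  apply: (cvgr_to_le (@pr_nondecreasing_cvg _ mu (fun l => F N j `&` G l) _ _)).
  - by move=> l; exact: measurableI.
  - move=> l l' ll'; apply/subsetPset => x [Fx [k /andP[kl lk] Ex]]; split => //.
    by exists k => //; rewrite kl (leq_trans lk)// leq_add2l.
  apply: nearW => l; rewrite ler_pdivlMl//; apply: le_trans (stopped l) _.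
  apply: le_pr; [|exact: measurableI|by move=> x [[]]].
  by apply: measurableI => //; exact: measurableI.
have hit1 N : m (hitfrom N) = 1.
  (* Let [j] tend to infinity in [step]: the right-hand sides decrease to the measure of the empty
     set. *)
  have : c * m (~` hitfrom N) <= 0.
    rewrite -[leRHS](pr0 mu).
    have <- : \bigcap_j (F N j `&` hitfrom N) = set0.
      rewrite -subset0 => x Fx; have [_ [k _ Hk]] := Fx 0%N I.
      by have [/(_ k (ltnSn k))] := Fx k.+1 I.
    apply: (cvgr_to_ge (@pr_nonincreasing_cvg _ mu (fun j => F N j `&` hitfrom N) _ _)).
    - by move=> j; exact: measurableI.
    - move=> j j' jj'; apply/subsetPset => x [Fx Hx]; split => // k kj; apply: Fx.
      exact: leq_trans jj'.
    apply: nearW => j; apply: le_trans (step N j).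
    rewrite ler_pM2l//; apply: le_pr => //; first exact: measurableC.
    by move=> x nH k _ Hk; apply: nH; exists k.
  rewrite pmulr_rle0// prC// => h; apply/eqP; rewrite eq_le pr_le1//=.
  by move: h; rewrite subr_le0.
apply/eqP; rewrite eq_le pr_le1/=; last first.
  by apply: measurable_io => k; exact: fdep_measurable (@dH _).
rewrite ioE; apply: (cvgr_to_ge (@pr_nonincreasing_cvg _ mu hitfrom _ _)) => //.
  move=> N N' NN'; apply/subsetPset => x [k _ Hk]; exists (N' + k - N)%N => //.
  by rewrite subnKC// (leq_trans NN')// leq_addr.
by apply: nearW => N; rewrite hit1.
Qed.

End Mixing.

(** * Subshifts of finite type *)

Section Subshift.
Variables (K : nat) (A : 'M[int]_K).

Lemma adm_bounds a b : adm A a b -> (1 <= a <= K)%N && (1 <= b <= K)%N.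
Proof.
by move=> /existsP[i /existsP[j /and3P[/eqP <- /eqP <- _]]]; rewrite /= !ltn_ord.
Qed.

Lemma SigmaAP x : SigmaA A x <-> forall l, adm A (x l) (x l.+1).
Proof.
split=> [[]//|h]; split=> // l.
by have /andP[] := adm_bounds (h l).
Qed.

Lemma SigmaA_sshift x : SigmaA A x -> SigmaA A (sshift x).
Proof. by move=> /SigmaAP h; apply/SigmaAP => l; exact: h. Qed.

Lemma SigmaA_le x : SigmaA A x -> forall i, (x i <= K)%N.
Proof. by case=> Kx _ i; have /andP[] := Kx i. Qed.

Lemma measurable_SigmaA : measurable (SigmaA A : set SeqSpace).
Proof.
pose S l : set SeqSpace := [set x | adm A (x l) (x l.+1)].
have -> : SigmaA A = \bigcap_l S l.
  apply/seteqP; split => x; first by move=> /SigmaAP h l _; exact: h.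
  by move=> h; apply/SigmaAP => l; exact: h.
apply: bigcapT_measurable => l; apply: (@fdep_measurable l.+2) => x y e.
by rewrite /S /= !e.
Qed.

Lemma SigmaA_glue (t z : seqT) N : (forall l, (l < N)%N -> adm A (t l) (t l.+1)) ->
  SigmaA A z -> z 0%N = t N ->
  exists y, [/\ SigmaA A y, forall l, (l <= N)%N -> y l = t l & iter N sshift y = z].
Proof.
move=> ht /SigmaAP hz zt; pose y : seqT := fun l => if (l < N)%N then t l else z (l - N)%N.
have yt l : (l <= N)%N -> y l = t l.
  by rewrite leq_eqVlt /y => /orP[/eqP ->|->//]; rewrite ltnn subnn.
have yz l : y (N + l)%N = z l.
  by rewrite /y ltnNge leq_addr/= addKn.
exists y; split => //; last by apply/funext => l; rewrite iter_sshift.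
apply/SigmaAP => l; have [lN|Nl] := ltnP l N.
  by rewrite !yt ?ht// ltnW.
by rewrite -(subnKC Nl) -addnS !yz.
Qed.

Hypothesis A01 : forall i j, A i j = 0 \/ A i j = 1.

(** A positive entry of a matrix product has a positive term, which yields the last edge of the
    path. Matrix index [i] stands for the symbol [i.+1]. *)
Lemma mxpow_path M i j : 0 < mxpow A M i j -> exists t : seqT,
  [/\ t 0%N = i.+1, t M = j.+1 & forall l, (l < M)%N -> adm A (t l) (t l.+1)].
Proof.
elim: M j => [|M IH] j.
  rewrite /mxpow/= mxE; have [-> _|_] := eqVneq i j; last by rewrite ltxx.
  by exists (fun=> j.+1).
rewrite /mxpow iterS mxE => Mij.
have [k] : exists k, 0 < mxpow A M i k * A k j.
  apply/not_existsP => h; move: Mij; rewrite ltNge => /negP; apply.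
  by apply: sumr_le0 => k _; rewrite leNgt; apply/negP/h.
have [->|Akj] := A01 k j; first by rewrite mulr0 ltxx.
rewrite Akj mulr1 => /IH [t [t0 tM ht]].
exists (fun l => if (l <= M)%N then t l else j.+1); split => //=; first by rewrite ltnn.
move=> l; rewrite ltnS => leM; rewrite leM; have [lM|Ml] := ltnP l M; first exact: ht.
have -> : l = M by apply/eqP; rewrite eqn_leq leM.
rewrite tM; apply/existsP; exists k; apply/existsP; exists j.
by rewrite !eqxx Akj.
Qed.

Variable M : nat.
Hypothesis AM : forall i j, 0 < mxpow A M i j.

Lemma letter_path a b : (1 <= a <= K)%N -> (1 <= b <= K)%N -> exists t : seqT,
  [/\ t 0%N = a, t M = b & forall l, (l < M)%N -> adm A (t l) (t l.+1)].
Proof.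
case: a => // a aK; case: b => // b bK.
exact: (mxpow_path (AM (Ordinal aK) (Ordinal bK))).
Qed.

Lemma SigmaA_connect x z q : SigmaA A x -> SigmaA A z ->
  exists y : seqT, [/\ SigmaA A y, agree x q.+1 y & iter (q + M) sshift y = z].
Proof.
move=> Xx Xz; have [t [t0 tM ht]] := letter_path (Xx.1 q) (Xz.1 0%N).
pose t' : seqT := fun l => if (l <= q)%N then x l else t (l - q)%N.
have t'x l : (l <= q)%N -> t' l = x l by rewrite /t' => ->.
have t't l : t' (q + l)%N = t l.
  case: l => [|l]; first by rewrite addn0 t'x.
  by rewrite /t' -{2}[q]addn0 leq_add2l/= addKn.
have [l|||y [Xy yt yz]] := @SigmaA_glue t' z (q + M) => //.
- move=> lqM; have [lq|ql] := ltnP l q.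
    by rewrite !t'x ?(ltnW lq)//; exact: Xx.2.
  rewrite -(subnKC ql) -addnS !t't; apply: ht.
  by rewrite ltn_subLR.
- by rewrite t't.
- exists y; split => // l lq; rewrite yt ?t'x//.
  by apply: leq_trans (leq_addr _ _).
Qed.

Hypothesis K2 : (2 <= K)%N.

(** The zeroth power is the identity, which has a zero off the diagonal. *)
Lemma connect_gt0 : (0 < M)%N.
Proof.
rewrite lt0n; apply/eqP => M0.
have := AM (Ordinal (ltnW K2)) (Ordinal K2).
by rewrite M0 /mxpow/= mxE.
Qed.

(** Prefix [x] with an admissible path that starts at a letter other than [a]. *)
Lemma SigmaA_two x a : SigmaA A x -> exists2 z : seqT, SigmaA A z & z 0%N != a.
Proof.
move=> Xx; pose c := if a == 1%N then 2%N else 1%N.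
have ca : c != a by rewrite /c; case: (eqVneq a 1%N) => [->|]//; rewrite eq_sym.
have cK : (1 <= c <= K)%N by rewrite /c; case: ifP => _ /=; [exact: K2|exact: ltnW].
have [t [t0 tM ht]] := letter_path cK (Xx.1 0%N).
have [z [Xz zt _]] := SigmaA_glue ht Xx (esym tM).
by exists z => //; rewrite zt// t0.
Qed.

Lemma sdist_le (R : realType) (x y : seqT) n :
  (sdist K x y <= ((K%:R : R) ^+ n)^-1) <-> agree y n x.
Proof.
have K0 : 0 < K%:R :> R by rewrite ltr0n ltnW.
rewrite /sdist; case: pselect => [h|h]; last first.
  split=> [_ i _|_]; last by rewrite invr_ge0 exprn_ge0// ltW.
  by apply/eqP; apply: contra_notT h => xy; exists i.
case: ex_minnP => j xyj jmin.
rewrite lef_pV2 ?posrE ?exprn_gt0// ler_eXn2l ?ltr1n//; split => [nj i il|xy].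
  by apply/eqP; apply: contraTT il => /jmin ji; rewrite -leqNgt (leq_trans nj).
by rewrite leqNgt; apply/negP => /xy xyj'; move: xyj; rewrite xyj' eqxx.
Qed.

End Subshift.

(** * Gibbs measures *)

Section Gibbs.
Variables (R : realType) (K : nat) (A : 'M[int]_K) (f : seqT -> R).
Variable mu : probability SeqSpace R.
Hypothesis fh : holder A f.
Hypothesis muG : is_gibbs A f mu.
Local Notation m := (pr mu).
Local Notation X := (SigmaA A : set SeqSpace).

Lemma gibbs_conull : mu X = 1%E.
Proof. by case: muG. Qed.

Lemma gibbs_nonempty : exists x, X x.
Proof.
apply/not_existsP => h; have := gibbs_conull.
rewrite (_ : SigmaA A = set0) ?measure0; first by move/eqP; rewrite eqe eq_sym oner_eq0.
by apply/seteqP; split => x // /h.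
Qed.

Lemma gibbs_invariant (B : set SeqSpace) : measurable B -> mu (sshift @^-1` B) = mu B.
Proof.
move=> mB; have [_ [inv _]] := muG.
have mS : measurable (sshift @^-1` B : set SeqSpace).
  exact: (@measurable_iter_sshift 1 B).
rewrite -(inv B mB) !prE//; last exact: measurableI (measurable_SigmaA A) mS.
by rewrite setIC (pr_setIX (measurable_SigmaA A) gibbs_conull).
Qed.

Lemma pr_cylA x n : fine (mu (cylA A (word_restr x n) : set SeqSpace)) = m (agree x n).
Proof.
rewrite -(pr_setIX (measurable_SigmaA A) gibbs_conull); last exact: measurable_agree.
by rewrite /cylA -cyl_mkseq.
Qed.

Lemma birkD n k x : birk f (n + k) x = birk f n x + birk f k (iter n sshift x).
Proof.
rewrite /birk big_split_ord/=; congr (_ + _); apply: eq_bigr => i _.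
by rewrite -iterD addnC.
Qed.

(** The Gibbs weight is exactly multiplicative along orbits; this is the source of the
    quasi-Bernoulli property. *)
Let weight n x : R := expR (- (n%:R * top_pressure A f) + birk f n x).

Lemma weightD n k x : weight (n + k) x = weight n x * weight k (iter n sshift x).
Proof. by rewrite /weight -expRD birkD natrD; congr expR; ring. Qed.

Lemma gibbs_bounds : exists2 C : R, 1 < C & forall x n, X x ->
  weight n x <= C * m (agree x n) /\ m (agree x n) <= C * weight n x.
Proof.
have [_ [_ [_ [C [C1 h]]]]] := muG; exists C => // x n Xx.
have := h x n Xx; rewrite pr_cylA -/(weight n x) => /andP[].
have w0 : 0 < weight n x by exact: expR_gt0.
rewrite ler_pdivlMr// ler_pdivrMr// ler_pdivrMl//.
exact: lt_trans ltr01 C1.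
Qed.

Lemma gibbs_quasi_bernoulli : exists Q : R, [/\ 1 <= Q,
  forall x n k, X x ->
    m (agree x (n + k)) <= Q * (m (agree x n) * m (agree (iter n sshift x) k)) &
  forall x n k, X x ->
    m (agree x n) * m (agree (iter n sshift x) k) <= Q * m (agree x (n + k))].
Proof.
have [C C1 h] := gibbs_bounds; have C0 : 0 < C by exact: lt_trans C1.
(* One factor [C] for each of the three cylinders compared. *)
exists (C ^+ 3); split; first by rewrite exprn_ege1// ltW.
- move=> x n k Xx; have [_ le1] := h x (n + k)%N Xx.
  have [le2 _] := h x n Xx; have [le3 _] := h _ k (X_iter (@SigmaA_sshift _ A) n Xx).
  apply: le_trans le1 _; rewrite weightD.
  have -> : C ^+ 3 * (m (agree x n) * m (agree (iter n sshift x) k)) =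
      C * ((C * m (agree x n)) * (C * m (agree (iter n sshift x) k))) by ring.
  by rewrite ler_pM2l//; apply: ler_pM => //; exact: expR_ge0.
- move=> x n k Xx; have [le1 _] := h x (n + k)%N Xx.
  have [_ le2] := h x n Xx; have [_ le3] := h _ k (X_iter (@SigmaA_sshift _ A) n Xx).
  apply: le_trans (ler_pM (pr_ge0 _ _) (pr_ge0 _ _) le2 le3) _.
  rewrite mulrACA -weightD.
  have -> : C ^+ 3 * m (agree x (n + k)) = C * C * (C * m (agree x (n + k))) by ring.
  by rewrite ler_pM2l ?mulr_gt0.
Qed.

(** The Hölder estimate with no common letters bounds the oscillation of [f] by [b]. *)
Lemma holder_bounded : exists F : R, forall x, X x -> `|f x| <= F.
Proof.
have [x0 Xx0] := gibbs_nonempty; have [b [al [_ [_ hb]]]] := fh.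
exists (`|f x0| + b) => x Xx; have := hb x x0 Xx Xx0 0%N.
rewrite expr0 mulr1 => /(_ (fun i (il : (i < 0)%N) => ltac:(done))) le.
rewrite -[f x](subrK (f x0)) addrC.
by apply: le_trans (ler_normD _ _) _; rewrite lerD2l.
Qed.

Lemma gibbs_lower k : exists2 c : R, 0 < c & forall x, X x -> c <= m (agree x k).
Proof.
have [C C1 h] := gibbs_bounds; have C0 : 0 < C by exact: lt_trans C1.
have [F hF] := holder_bounded.
exists (C^-1 * expR (- (k%:R * top_pressure A f) - k%:R * F)).
  by rewrite mulr_gt0 ?invr_gt0 ?expR_gt0.
move=> x Xx; rewrite ler_pdivrMl//; apply: le_trans (h x k Xx).1.
rewrite ler_expR lerD2l /birk -[leLHS]opprK lerNl opprK -sumrN.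
apply: le_trans (_ : \sum_(i < k) F <= _); last by rewrite sumr_const card_ord mulr_natl.
apply: ler_sum => i _; apply: le_trans (ler_norm _) _; rewrite normrN.
by apply: hF; apply: X_iter => //; exact: SigmaA_sshift.
Qed.

End Gibbs.

(** * Upper limits and the fibres of [psi] *)

Lemma limn_esup_gt (R : realType) (u : (\bar R)^nat) (l : \bar R) :
  (l < limn_esup u)%E -> forall N, exists2 k, (N <= k)%N & (l < u k)%E.
Proof.
move=> lu N; apply/not_exists2P => h; move: lu; rewrite ltNge => /negP; apply.
rewrite limn_esup_lim; apply: lime_le; first exact: is_cvg_esups.
near=> n; apply: ge_ereal_sup => _ [k /= nk <-].
have [|/negP] := h k; last by rewrite -leNgt.
by case; apply: leq_trans nk; near: n; exact: nbhs_infty_ge.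
Unshelve. all: by end_near. Qed.

Lemma fdep_measurable_fun d (T : measurableType d) L (u : SeqSpace -> T) :
  (forall x y : seqT, (forall i, (i < L)%N -> x i = y i) -> u x = u y) ->
  measurable_fun setT u.
Proof.
move=> du _ Y mY; rewrite setTI; apply: (@fdep_measurable L) => x y e /=.
by rewrite (du _ _ e).
Qed.

Lemma npreim_seq (R : realType) (psi : nat -> nat) n (s : seq nat) : uniq s ->
  (forall p, p \in s = (0 < p)%N && (psi p == n)) ->
  npreim psi n = ((size s)%:R : R)%:E.
Proof.
move=> us sE; rewrite /npreim.
have -> : [set p | (0 < p)%N /\ psi p = n] = [set` s].
  apply/seteqP; split => p /=; rewrite sE; first by move=> [-> ->]; rewrite eqxx.
  by move=> /andP[-> /eqP].
rewrite esum_fset//; last exact: finite_seq.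
by rewrite -fsbig_seq// sumEFin big_const_seq count_predT iter_addr_0.
Qed.

Lemma preim_finite (psi : nat -> nat) :
  (forall M, exists N, forall n, (N <= n)%N -> (M <= psi n)%N) ->
  forall n, exists2 s : seq nat, uniq s & forall p, p \in s = (0 < p)%N && (psi p == n).
Proof.
move=> psioo n; have [N hN] := psioo n.+1.
exists [seq p <- iota 0 N | (0 < p)%N && (psi p == n)].
  by rewrite filter_uniq ?iota_uniq.
move=> p; rewrite mem_filter mem_iota/= add0n.
have [pN|Np] := ltnP p N; first by rewrite andbT.
by rewrite andbF; apply/esym/negP => /andP[_ /eqP pn]; have := hN p Np; rewrite pn ltnn.
Qed.

(** Only finitely many [p] can violate [psi p <= p], and their values stay below [W]. The condition
    on the value suits fibres, where [psi p] is what is known. *)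
Lemma preim_ge (psi : nat -> nat) :
  (exists N, forall n, (N <= n)%N -> (psi n <= n)%N) ->
  exists W, forall p, (W <= psi p)%N -> (psi p <= p)%N.
Proof.
move=> [N hN]; exists (\max_(p < N) psi p).+1 => p pW.
have [pN|/hN//] := ltnP p N.
move: pW; rewrite ltnNge => /negP[].
exact: (leq_bigmax (Ordinal pN)).
Qed.

(** The discarded elements are distinct and among the [M] integers from [n] on. *)
Lemma size_filter_ge (s : seq nat) n M : uniq s -> (forall p, p \in s -> (n <= p)%N) ->
  (size s <= size [seq p <- s | (n + M <= p)%N] + M)%N.
Proof.
move=> us sn; rewrite size_filter -(count_predC (fun p => (n + M <= p)%N) s) leq_add2l.
rewrite -size_filter -[leqRHS](size_iota n); apply: uniq_leq_size.
  by rewrite filter_uniq.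
by move=> p; rewrite mem_filter mem_iota /= -ltnNge => /andP[-> /sn ->].
Qed.

(** * Full measure of the two recurrence sets *)

Theorem theorem2p2 (R : realType) (K : nat) (A : 'M[int]_K)
  (f : seqT -> R) (mu : probability SeqSpace R)
  (psi : nat -> nat) (nk : nat -> nat) (g : nat -> R) :
  (2 <= K)%N ->
  (forall i j, A i j = 0 \/ A i j = 1) ->
  (exists M : nat, forall i j, 0 < mxpow A M i j) ->
  holder A f ->
  ~ cohom_const A f ->
  is_gibbs A f mu ->
  (exists N, forall n, (N <= n)%N -> (psi n <= n)%N) ->
  (forall M, exists N, forall n, (N <= n)%N -> (M <= psi n)%N) ->
  (forall k, (nk k < nk k.+1)%N) ->
  (forall n, 1 <= g n) ->
  (fun n => g n / g n.+1) @ \oo --> (1 : R) ->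
  mu ([set x | SigmaA A x /\
        (1 < limn_esup (fun k =>
           ((ln (fine (mu (cylA A (word_restr x (nk k)) : set SeqSpace)))
             + ks_entropy A mu * (nk k)%:R)
            / (Num.sqrt (2 * asym_variance A mu f * (nk k)%:R) * g (nk k)))%:E))%E]
      : set SeqSpace) = 1%E ->
  (fun k => ((npreim psi (nk k) : \bar R) *
     (expR (- (ks_entropy A mu * (nk k)%:R)
            + Num.sqrt (2 * asym_variance A mu f * (nk k)%:R) * g (nk k)))%:E)%E)
    @ \oo --> +oo%E ->
  mu ([set x | SigmaA A x /\ forall N, exists k, (N <= k)%N /\
         exists p, [/\ (0 < p)%N, psi p = nk k &
           sdist K (iter p sshift x) x <= ((K%:R : R) ^+ nk k)^-1]]
      : set SeqSpace) = 1%E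
  /\ mu (@Rpsi K A R psi : set SeqSpace) = 1%E.
Proof.
move=> K2 A01 [M AM] fh _ muG psile psioo nkS g1 _ mugood counts.
pose X : set SeqSpace := SigmaA A.
have mX : measurable X := measurable_SigmaA A.
have X1 : mu X = 1%E := gibbs_conull muG.
have XS := @SigmaA_sshift K A.
have XK := @SigmaA_le K A.
have [Q [Q1 QBu QBl]] := gibbs_quasi_bernoulli muG.
have low := gibbs_lower fh muG.
have [x0 Xx0] := gibbs_nonempty muG.
have [c c0 hret] := return_probability mX X1 XS XK (gibbs_invariant muG) Q1 QBu QBl low
  (connect_gt0 AM K2) (@SigmaA_connect K A A01 M AM)
  (fun a => SigmaA_two A01 AM K2 a Xx0).
have nk_ge := strictly_increasing_ge nkS.
have [W hW] := preim_ge psile.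
pose s k := s2val (cid2 (preim_finite psioo (nk k))).
have us k : uniq (s k) by rewrite /s; case: cid2.
have sE k p : p \in s k = (0 < p)%N && (psi p == nk k) by rewrite /s; case: cid2.
have s_ge k p : (W <= k)%N -> p \in s k -> (nk k <= p)%N.
  move=> Wk; rewrite sE => /andP[_ /eqP pk].
  by rewrite -pk; apply: hW; rewrite pk (leq_trans Wk).
(* The connecting words of [SigmaA_connect] rule out at most M return times. *)
pose r k := [seq p <- s k | (nk k + M <= p)%N].
have rs k p : p \in r k -> p \in s k by rewrite mem_filter => /andP[].
pose E k : set SeqSpace := [set x | 1 <= (size (r k))%:R * pr mu (agree x (nk k))].
have dE k : fdep (nk k) (E k).
  by move=> x y e; rewrite /E /= (@agree_eq y x)// => i il; rewrite e.
have Eio : pr mu (io E) = 1.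
  set h := ks_entropy A mu in mugood counts.
  set rho := asym_variance A mu f in mugood counts.
  pose u k (x : SeqSpace) : \bar R :=
    ((ln (fine (mu (cylA A (word_restr x (nk k)) : set SeqSpace))) + h * (nk k)%:R)
      / (Num.sqrt (2 * rho * (nk k)%:R) * g (nk k)))%:E.
  pose Om : set SeqSpace := [set x | X x /\ (1 < limn_esup (u ^~ x))%E].
  have mOm : measurable Om.
    have mu_ k : measurable_fun setT (u k).
      apply: (@fdep_measurable_fun _ _ (nk k)) => x y e; rewrite /u.
      have -> // : word_restr x (nk k) = word_restr y (nk k).
      by apply/eq_in_map => i; rewrite mem_iota => /andP[_ il]; exact: e.
    have := measurable_fun_limn_esup mu_ measurableT (emeasurable_itv `]1%E, +oo[).
    rewrite setTI => /(measurableI _ _ mX).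
    congr measurable; apply/seteqP; split => x [Xx].
      by rewrite /= in_itv/= andbT.
    by move=> ux; split => //=; rewrite in_itv/= andbT.
  have Om1 : pr mu Om = 1 by rewrite /pr [X in fine X]mugood.
  (* Up to [M] times are lost in passing from [s k] to [r k], at a cost of at most [M] as cylinders
     have measure at most 1; the remaining 1 is what [E k] requires. *)
  have [k1 _ hk1] := (cvgeyPge _).1 counts (M%:R + 1).
  apply/eqP; rewrite eq_le pr_le1/=; last first.
    by apply: measurable_io => k; exact: fdep_measurable (@dE _).
  rewrite -Om1; apply: le_pr => //.
    by apply: measurable_io => k; exact: fdep_measurable (@dE _).
  move=> x [Xx ux] N; have [k] := limn_esup_gt ux (maxn N (maxn k1 W)).
  rewrite !geq_max => /and3P[Nk k1k Wk] uk; exists k; split => //.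
  move: uk; rewrite /u lte_fin (pr_cylA muG).
  have := hk1 k k1k; rewrite /= (npreim_seq R (us k) (sE k)) -EFinM lee_fin.
  have [d d0 lowd] := low (nk k); have a0 := lt_le_trans d0 (lowd _ Xx).
  have a1 := pr_le1 mu (measurable_agree x (nk k)).
  set a := pr mu (agree x (nk k)) in a0 a1 *; set D := Num.sqrt _ * _.
  move=> many dev.
  (* Division by zero yields 0, so a quotient above 1 excludes [D = 0]. *)
  have D0 : 0 < D.
    rewrite lt_neqAle mulr_ge0 ?sqrtr_ge0 ?(le_trans ler01)// andbT eq_sym.
    by apply: contraTneq dev => ->; rewrite invr0 mulr0 ltr10.
  move: dev; rewrite ltr_pdivlMr// mul1r -ltrBlDr => dev.
  have big : expR (- (h * (nk k)%:R) + D) <= a.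
    by rewrite -[leRHS](lnK a0) ler_expR addrC ltW.
  have size_le : (size (s k))%:R <= (size (r k))%:R + M%:R :> R.
    by rewrite -natrD ler_nat; apply: size_filter_ge => // p; exact: s_ge.
  rewrite /E /= -/a.
  (* The chain is: [M + 1] is at most [size (s k) * a], which is at most [size (r k) * a + M]. *)
  have := ler_wpM2l (ler0n R (size (s k))) big.
  have := ler_wpM2r (ltW a0) size_le.
  have := ler_wpM2l (ler0n R M) a1.
  by move: many; lra.
have Hio : pr mu (io (fun k => returns (r k) (nk k))) = 1.
  apply: (infinitely_often mX X1 XS XK nkS c0 dE (fun k => @fdep_returns (r k) (nk k))) => //.
  move=> k x Xx Ex; apply: hret => //; first by rewrite filter_uniq.
  by move=> p; rewrite mem_filter => /andP[].
have full (S : set SeqSpace) : measurable S ->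
    X `&` io (fun k => returns (r k) (nk k)) `<=` S -> mu S = 1%E.
  move=> mS HS; rewrite prE//; congr EFin; apply/eqP; rewrite eq_le pr_le1//= -Hio.
  apply: (le_prX mX X1) => //; last by rewrite setIC.
  by apply: measurable_io => k; exact: fdep_measurable (@fdep_returns _ _).
split; apply: full.
- rewrite [X in measurable X](_ : _ = X `&` io (fun k => returns (s k) (nk k))).
    apply: measurableI => //; apply: measurable_io => k.
    exact: fdep_measurable (@fdep_returns _ _).
  apply/seteqP; split => x [Xx hx]; split => // N; have [k [Nk]] := hx N.
    move=> [p [p0 pk /(sdist_le K2) px]]; exists k; split => //; exists p => //.
    by rewrite sE p0 pk eqxx.
  move=> [p]; rewrite sE => /andP[p0 /eqP pk] px; exists k; split => //.
  by exists p; split => //; apply/(sdist_le K2).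
- move=> x [Xx hx]; split => // N; have [k [Nk [p /rs]]] := hx N.
  rewrite sE => /andP[p0 /eqP pk] px; exists k; split => //.
  by exists p; split => //; apply/(sdist_le K2).
- pose V n : set SeqSpace := [set x | (0 < n)%N /\ agree x (psi n) (iter n sshift x)].
  rewrite [X in measurable X](_ : _ = X `&` io V).
    apply: measurableI => //; apply: measurable_io => n.
    apply: (@fdep_measurable (n + psi n)) => x y e [n0 xn]; split => // i il.
    have := xn i il; rewrite !iter_sshift !e// ?ltn_add2l//.
    exact: leq_trans il (leq_addl _ _).
  apply/seteqP; split => x [Xx hx]; split => // N; have [n] := hx N.
    by move=> [Nn n0 /(sdist_le K2) xn]; exists n.
  by move=> [Nn [n0 xn]]; exists n; split => //; apply/(sdist_le K2).
(* Infinitely many [k] give unbounded return times: for [k] at least [W], [p] is at least [nk k],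
   hence at least [k]. The closeness is the required one because [psi p = nk k]. *)
- move=> x [Xx hx]; split => // N; have [k [Nk [p /rs ps]]] := hx (maxn N W).
  have := ps; rewrite sE => /andP[p0 /eqP pk] px; exists p; split => //.
    move: Nk; rewrite geq_max => /andP[Nk Wk].
    by rewrite (leq_trans Nk)// (leq_trans (nk_ge k))// s_ge.
  by apply/(sdist_le K2); rewrite pk.
Qed.
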